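(* Let $q$ be a prime power, $2\le n\le m$ integers, $\mathcal{C}\le\mathbb{F}_q^{n\times m}$ an $\mathbb{F}_q$-linear subspace of dimension $k$, and $0\le i\le k$. Let $$\varphi_n(X,Y,T):=\sum_{u=0}^n\mathcal{B}_{n,u}(X,Y;q)T^{n-u}.$$ Then $W_\mathcal{C}^{(i)}(X,Y)$ is the coefficient of $T^{n-d_i}$ in $Z_\mathcal{C}^{(i)}(T)\,\varphi_n(X,Y,T)$.
   Context: The dual is $\mathcal{C}^\perp=\{N\in\mathbb{F}_q^{n\times m}:\operatorname{Tr}(MN^t)=0\ \forall M\in\mathcal{C}\}$; $d^\perp$ is the minimum rank of a nonzero element of $\mathcal{C}^\perp$, and $d^\perp=n+1$ if $\mathcal{C}^\perp=\{0\}$. An optimal anticode is a subspace $A\le\mathbb{F}_q^{n\times m}$ with $\dim A=m\cdot\max\{\operatorname{rk}(M):M\in A\}$, and $d_i=\frac1m\min\{\dim A: A\text{ an optimal anticode},\ \dim(A\cap\mathcal{C})\ge i\}$. For integers $a,b$, $\begin{bmatrix} a \\ b \end{bmatrix}_q$ is $0$ if $b<0$ or $0\le a<b$; $1$ if $b=0$; $\prod_{s=1}^b\frac{q^{a-s+1}-1}{q^s-1}$ if $b>0$, $a\ge b$; $(-1)^bq^{ab-\binom b2}\begin{bmatrix} -a+b-1 \\ b \end{bmatrix}_q$ if $b>0$, $a<0$. $q$-Bernstein polynomials: $\mathcal{B}_{n,u}(X,Y;q)=\begin{bmatrix} n \\ u \end{bmatrix}_qY^u\prod_{j=0}^{n-u-1}(X-q^jY)$.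 Weight enumerator: for $W\le\mathbb{F}_q^n$ let $A_W^{(i)}(\mathcal{C},c)$ (respectively, for $n=m$, $A_W^{(i)}(\mathcal{C},r)$) be the number of $i$-dimensional subspaces $\mathcal{D}\le\mathcal{C}$ such that the sum of the column spaces (respectively row spaces) of the elements of $\mathcal{D}$ equals $W$. For $0\le w\le n$, $A_w^{(i)}(\mathcal{C})=\sum_{\dim W=w}A_W^{(i)}(\mathcal{C},c)$ if $n<m$ and $A_w^{(i)}(\mathcal{C})=\frac12\sum_{\dim W=w}(A_W^{(i)}(\mathcal{C},c)+A_W^{(i)}(\mathcal{C},r))$ if $n=m$. Then $W_\mathcal{C}^{(i)}(X,Y)=\sum_{w=0}^nA_w^{(i)}(\mathcal{C})X^{n-w}Y^w$. Binomial moments: for $U\le\mathbb{F}_q^n$ let $\mathcal{C}(U)$ (respectively, if $n=m$, $\mathcal{C}[U]$) be the set of $M\in\mathcal{C}$ with column space (respectively row space) contained in $U$. For $0\le u\le n$, $B_u^{(i)}(\mathcal{C})=\sum_{\dim U=u}\begin{bmatrix} \dim\mathcal{C}(U) \\ i \end{bmatrix}_q$ if $n<m$, and $B_u^{(i)}(\mathcal{C})=\frac12\sum_{\dim U=u}\Big(\begin{bmatrix} \dim\mathcal{C}(U) \\ i \end{bmatrix}_q+\begin{bmatrix} \dim\mathcal{C}[U] \\ i \end{bmatrix}_q\Big)$ if $n=m$. For integers $u$: $b_u^{(i)}(\mathcal{C})=0$ if $u<0$; $b_u^{(i)}(\mathcal{C})=B_{u+d_i}^{(i)}(\mathcal{C})\big/\begin{bmatrix}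 n \\ u+d_i \end{bmatrix}_q$ if $0\le u\le n-d^\perp-d_i$; $b_u^{(i)}(\mathcal{C})=\begin{bmatrix} k-m(n-u-d_i) \\ i \end{bmatrix}_q$ if $u\ge0$ and $u>n-d^\perp-d_i$. The $i$-th generalized zeta function is $Z_\mathcal{C}^{(i)}(T)=\sum_{u\ge0}b_u^{(i)}(\mathcal{C})T^u$. *)

(* Defs.v *)
From HB Require Import structures.
From mathcomp Require Import all_boot all_order all_algebra.
From mathcomp Require Import mpoly.

Set Implicit Arguments.
Unset Strict Implicit.
Unset Printing Implicit Defensive.

Import Order.TTheory GRing.Theory Num.Theory.

Local Open Scope ring_scope.

(* Subspaces of a finite vector space form a finite type, so that they can be
   counted and summed over. *)
Section FiniteVspace.

Import VectorInternalTheory.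

Variables (F : finFieldType) (vT : vectType F).

HB.instance Definition _ := [Countable of {vspace vT} by <:].
HB.instance Definition _ := [Finite of {vspace vT} by <:].

End FiniteVspace.

Definition qbinom_prod (q : nat) (a b : int) : rat :=
  \prod_(1 <= s < `|b|%N.+1)
    ((q%:R ^ (a - s%:Z + 1) - 1) / (q%:R ^+ s - 1)).

(* The last branch has b > 0 and a < 0, hence - a + b - 1 >= b > 0, so the
   Gaussian coefficient it refers to is given by the product formula. *)
Definition qbinom (q : nat) (a b : int) : rat :=
  if (b < 0) || (0 <= a < b) then 0
  else if b == 0 then 1
  else if b <= a then qbinom_prod q a b
  else (-1) ^ b * q%:R ^ (a * b - 'C(`|b|, 2)%:Z)
         * qbinom_prod q (- a + b - 1) b.

(* X and Y are the variables 'X_0 and 'X_1. *)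
Definition bernstein (q n u : nat) : {mpoly rat[2]} :=
  qbinom q n%:Z u%:Z *:
    ('X_1 ^+ u * \prod_(j < n - u) ('X_0 - q%:R ^+ j *: 'X_1)).

(* The outer variable 'X of this univariate polynomial is T. *)
Definition phi (q n : nat) : {poly {mpoly rat[2]}} :=
  \sum_(u < n.+1) (bernstein q n u)%:P * 'X^(n - u).

(* Formal power series are represented by their sequences of coefficients;
   this is the Cauchy product. *)
Definition ps_mul (R : nzRingType) (f g : nat -> R) : nat -> R :=
  fun N => \sum_(j < N.+1) f j * g (N - j)%N.

Section Code.

Variables (F : finFieldType) (n m : nat).
Implicit Types (M : 'M[F]_(n, m)) (C D A : {vspace 'M[F]_(n, m)}).

Let q := #|F|.

Definition colspace M : {vspace 'cV[F]_n} := <<[seq col j M | j : 'I_m]>>%VS.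

Definition rowspace M : {vspace 'rV[F]_m} := <<[seq row j M | j : 'I_n]>>%VS.

Definition dual_code C : {set 'M[F]_(n, m)} :=
  [set N | [forall M in C, \tr (M *m N^T) == 0]].

(* Ranks are at most n, so the default value n + 1 of the minimum is reached
   exactly when the dual is zero. *)
Definition dual_dist C : nat :=
  \big[minn/n.+1]_(N in dual_code C | N != 0) \rank N.

Definition optimal_anticode A : bool :=
  \dim A == (m * \max_(M in A) \rank M)%N.

(* The dimension of an optimal anticode is a multiple of m, so the division is
   exact. For n <= m the whole matrix space, of dimension m * n, is an optimal
   anticode, so the default value of the minimum is harmless if i <= \dim C. *)
Definition gen_weight C (i : nat) : nat :=
  (\big[minn/(m * n)%N]_(A : {vspace 'M[F]_(n, m)} |
      optimal_anticode A && (i <= \dim (A :&: C))%N) \dim A %/ m)%N.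

Definition num_col C (i : nat) (W : {vspace 'cV[F]_n}) : nat :=
  #|[set D : {vspace 'M[F]_(n, m)} | [&& (D <= C)%VS, \dim D == i
      & (\sum_(M in D) colspace M)%VS == W]]|.

Definition num_row C (i : nat) (W : {vspace 'rV[F]_m}) : nat :=
  #|[set D : {vspace 'M[F]_(n, m)} | [&& (D <= C)%VS, \dim D == i
      & (\sum_(M in D) rowspace M)%VS == W]]|.

(* Row spaces live in F^m; they are only used when n = m. *)
Definition weight_num C (i w : nat) : rat :=
  let Ac := \sum_(W : {vspace 'cV[F]_n} | \dim W == w) (num_col C i W)%:R in
  let Ar := \sum_(W : {vspace 'rV[F]_m} | \dim W == w) (num_row C i W)%:R in
  if n == m then (Ac + Ar) / 2%:R else Ac.

Definition weight_enum C (i : nat) : {mpoly rat[2]} :=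
  \sum_(w < n.+1) weight_num C i w *: ('X_0 ^+ (n - w) * 'X_1 ^+ w).

(* C(U) and C[U]; by mem_short_col and mem_short_row below, taking the span
   does not add any element. *)
Definition short_col C (U : {vspace 'cV[F]_n}) : {vspace 'M[F]_(n, m)} :=
  <<enum [pred M in C | (colspace M <= U)%VS]>>%VS.

Definition short_row C (U : {vspace 'rV[F]_m}) : {vspace 'M[F]_(n, m)} :=
  <<enum [pred M in C | (rowspace M <= U)%VS]>>%VS.

Lemma mem_span_closed (P : pred 'M[F]_(n, m)) :
  P 0 -> (forall a M N, P M -> P N -> P (a *: M + N)) ->
  forall M, (M \in <<enum P>>%VS) = P M.
Proof.
move=> P0 Plin M; apply/idP/idP => [|PM]; last first.
  by apply: memv_span; rewrite mem_enum.
move/coord_span=> ->.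
have PD X Y : P X -> P Y -> P (X + Y).
  by move=> PX PY; rewrite -[X]scale1r; apply: Plin.
apply: (big_ind P) => // i _.
rewrite -[_ *: _]addr0; apply: Plin => //.
have lti : (i < size (enum P))%N by rewrite -cardE.
by have := mem_nth 0 lti; rewrite mem_enum.
Qed.

Lemma colspace_sub M (U : {vspace 'cV[F]_n}) :
  (colspace M <= U)%VS = [forall j, col j M \in U].
Proof.
apply/span_subvP/forallP => [sMU j | sMU _ /mapP[j _ ->]//].
by apply/sMU/map_f; rewrite mem_enum.
Qed.

Lemma rowspace_sub M (U : {vspace 'rV[F]_m}) :
  (rowspace M <= U)%VS = [forall j, row j M \in U].
Proof.
apply/span_subvP/forallP => [sMU j | sMU _ /mapP[j _ ->]//].
by apply/sMU/map_f; rewrite mem_enum.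
Qed.

Lemma mem_short_col C U M :
  (M \in short_col C U) = (M \in C) && (colspace M <= U)%VS.
Proof.
apply: (mem_span_closed (P := [pred M in C | (colspace M <= U)%VS])) => /=.
  rewrite mem0v colspace_sub; apply/forallP=> j.
  by rewrite linear0 mem0v.
move=> a {}M N; rewrite !colspace_sub => /andP[CM /forallP UM].
case/andP=> CN /forallP UN; rewrite memvD ?memvZ //=; apply/forallP=> j.
by rewrite linearP memvD ?memvZ ?UM ?UN.
Qed.

Lemma mem_short_row C U M :
  (M \in short_row C U) = (M \in C) && (rowspace M <= U)%VS.
Proof.
apply: (mem_span_closed (P := [pred M in C | (rowspace M <= U)%VS])) => /=.
  rewrite mem0v rowspace_sub; apply/forallP=> j.
  by rewrite linear0 mem0v.
move=> a {}M N; rewrite !rowspace_sub => /andP[CM /forallP UM].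
case/andP=> CN /forallP UN; rewrite memvD ?memvZ //=; apply/forallP=> j.
by rewrite linearP memvD ?memvZ ?UM ?UN.
Qed.

Definition binom_moment C (i u : nat) : rat :=
  let Bc := \sum_(U : {vspace 'cV[F]_n} | \dim U == u)
              qbinom q (\dim (short_col C U))%:Z i%:Z in
  let Br := \sum_(U : {vspace 'rV[F]_m} | \dim U == u)
              qbinom q (\dim (short_row C U))%:Z i%:Z in
  if n == m then (Bc + Br) / 2%:R else Bc.

Definition norm_moment C (i : nat) (u : int) : rat :=
  let d := (gen_weight C i)%:Z in
  if u < 0 then 0
  else if u <= n%:Z - (dual_dist C)%:Z - d then
    binom_moment C i (absz (u + d)) / qbinom q n%:Z (u + d)
  else qbinom q ((\dim C)%:Z - m%:Z * (n%:Z - u - d)) i%:Z.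

Definition zeta C (i : nat) : nat -> rat := fun u => norm_moment C i u%:Z.

End Code.

(* Main.v *)
(* Summing over the subcodes D of dimension i instead of over supports, the
   weight enumerator is the sum of X^(n-w) Y^w with w the dimension of the support
   of D. The q-binomial identity
     sum_v [N, v] Y^v prod_(j < N - v) (X - q^j Y) = X^N
   spreads each monomial over the subspaces U containing that support, which gives
     W(X, Y) = sum_u B_u Y^u prod_(j < n - u) (X - q^j Y).
   The matrices supported in U form an optimal anticode of dimension m dim U, so
   B_u = 0 for u < d_i; and for n - u < d^perp no nonzero dual codeword is
   orthogonal to that anticode, which forces dim C(U) = k - m (n - u). Hence
   B_u = [n, u] b_(u - d_i) for all u >= d_i, and the sum over u is the Cauchy
   product. *)
Require Import Defs.
From mathcomp Require Import all_boot all_order all_algebra all_field.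
From mathcomp Require Import mpoly zify ring.

Set Implicit Arguments.
Unset Strict Implicit.
Unset Printing Implicit Defensive.

Import Order.TTheory GRing.Theory Num.Theory.

Local Open Scope ring_scope.

(** * Gaussian coefficients and the q-binomial identity *)

Definition gauss (q a b : nat) : rat :=
  \prod_(s < b) ((q%:R ^+ (a - s) - 1) / (q%:R ^+ s.+1 - 1)).

Lemma expr_sub1_neq0 (q s : nat) : (1 < q)%N -> (q%:R ^+ s.+1 - 1 : rat) != 0.
Proof.
by move=> q1; rewrite subr_eq0 gt_eqF // exprn_egt1 // ltr1n.
Qed.

Lemma gauss_small q a b : (a < b)%N -> gauss q a b = 0.
Proof.
(* The factor at [s = a] is q^0 - 1 = 0. *)
move=> ltab; rewrite /gauss (bigD1 (Ordinal ltab)) //= subnn expr0 subrr.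
by rewrite !mul0r.
Qed.

Lemma gauss0 q a : gauss q a 0 = 1.
Proof. by rewrite /gauss big_ord0. Qed.

Lemma gauss_neq0 q a b : (1 < q)%N -> (b <= a)%N -> gauss q a b != 0.
Proof.
move=> q1 leba; apply/prodf_neq0 => s _; rewrite mulf_neq0 ?invr_eq0 //.
  by rewrite -(prednK (n := a - s)) ?expr_sub1_neq0 // subn_gt0 (leq_trans _ leba).
exact: expr_sub1_neq0.
Qed.

Lemma qbinomE q a b : qbinom q a%:Z b%:Z = gauss q a b.
Proof.
rewrite /qbinom ltz_nat lez_nat /=.
case: ltnP => [ltab|leba]; first by rewrite gauss_small.
case: eqVneq => [[->]|_]; first by rewrite gauss0.
rewrite /qbinom_prod /gauss big_add1 big_mkord.
apply: eq_bigr => s _; congr (_ / _); congr (_ - _).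
have les : (s <= a)%N by rewrite (leq_trans (ltnW (ltn_ord s))).
by have -> : a%:Z - s.+1%:Z + 1 = (a - s)%N%:Z by lia.
Qed.

Lemma gaussS q a b :
  gauss q a b.+1 = gauss q a b * ((q%:R ^+ (a - b) - 1) / (q%:R ^+ b.+1 - 1)).
Proof. by rewrite /gauss big_ord_recr. Qed.

Lemma gaussSS q a b : (1 < q)%N ->
  gauss q a.+1 b.+1 * (q%:R ^+ b.+1 - 1) = gauss q a b * (q%:R ^+ a.+1 - 1).
Proof.
move=> q1; rewrite /gauss !prodf_div big_ord_recl [in X in _ / X]big_ord_recr /=.
rewrite invfM mulrA mulfVK ?expr_sub1_neq0 // subn0 /=.
by rewrite [RHS]mulrAC [X in _ = X / _]mulrC.
Qed.

(** With x = q^(a-b) and y = q^(b+1), clearing denominators reduces the claim to x y - 1 = (x - 1) +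
    x (y - 1). *)
Lemma gauss_pascal q a b : (1 < q)%N -> (b <= a)%N ->
  gauss q a.+1 b.+1 = gauss q a b.+1 + q%:R ^+ (a - b) * gauss q a b.
Proof.
move=> q1 leba; have nz := expr_sub1_neq0 b q1.
apply: (mulIf nz); rewrite gaussSS // gaussS.
have -> : a.+1 = (a - b + b.+1)%N by rewrite addnS subnK.
rewrite exprD; move: (q%:R ^+ (a - b)) (q%:R ^+ b.+1) nz => x y nz.
by field.
Qed.

(** Induction on [N]: multiplication by [x] splits [P k] into [P k.+1] and q^k y [P k], and the two
    resulting sums, shifted against each other, recombine by the Pascal rule. *)
Lemma sum_bernstein (R : comAlgType rat) (q N : nat) (x y : R) : (1 < q)%N ->
  \sum_(v < N.+1) gauss q N v *:
    (y ^+ v * \prod_(j < N - v) (x - q%:R ^+ j *: y)) = x ^+ N.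
Proof.
move=> q1; pose P k := \prod_(j < k) (x - q%:R ^+ j *: y).
elim: N => [|N IHN].
  by rewrite big_ord1 gauss0 scale1r big_ord0 mulr1.
have xP k : x * P k = P k.+1 + q%:R ^+ k *: (y * P k).
  by rewrite /P big_ord_recr /= -/(P k) mulrBr -scalerAr [P k * y]mulrC subrK mulrC.
rewrite exprS -IHN mulr_sumr.
have xterm (v : 'I_N.+1) : x * (gauss q N v *: (y ^+ v * P (N - v)%N)) =
    gauss q N v *: (y ^+ v * P (N.+1 - v)%N)
    + (q%:R ^+ (N - v) * gauss q N v) *: (y ^+ v.+1 * P (N - v)%N).
  have leN : (v <= N)%N by rewrite -ltnS.
  rewrite -scalerAr mulrCA xP mulrDr scalerDr -scalerAr scalerA mulrA -exprSr.
  by rewrite (subSn leN) [gauss _ _ _ * _]mulrC.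
rewrite (eq_bigr _ (fun v _ => xterm v)).
rewrite big_split /= [LHS]big_ord_recl [X in _ = X + _]big_ord_recl /=.
rewrite !gauss0 -addrA; congr (_ + _).
(* The extra top term has coefficient [gauss q N N.+1], which is zero. *)
have -> : \sum_(i < N) gauss q N (bump 0 i) *:
    (y ^+ bump 0 i * P (N.+1 - bump 0 i)%N) =
    \sum_(i < N.+1) gauss q N i.+1 *: (y ^+ i.+1 * P (N - i)%N).
  by rewrite big_ord_recr /= gauss_small // scale0r addr0.
rewrite -big_split /=; apply: eq_bigr => v _.
have leN : (v <= N)%N by rewrite -ltnS.
by rewrite -scalerDl; congr (_ *: _); exact: gauss_pascal.
Qed.

(* [card_vspace] expects a carrier with a canonical finType structure. *)
Lemma card_finvect (F : finFieldType) (vT : vectType F) (U : {vspace vT}) :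
  #|[pred x : finvect_type vT | x \in U]|%:R = #|F|%:R ^+ \dim U :> rat.
Proof.
rewrite -natrX; congr _%:R; case: vT U => T c U.
exact: (@card_vspace F (finvect_type (Vector.Pack c)) c U).
Qed.

(** * Counting subspaces of a finite vector space *)

Section SubspaceCount.

Variables (F : finFieldType) (vT : vectType F).
Implicit Types (U V W : {vspace vT}) (x : vT).

Lemma card_field_gt1 : (1 < #|F|)%N.
Proof. exact: card_finNzRing_gt1. Qed.

Lemma dim_add_line W x : x \notin W -> \dim (W + <[x]>)%VS = (\dim W).+1.
Proof.
move=> xW; apply/eqP; rewrite eqn_leq; apply/andP; split.
  by rewrite (leq_trans (dimv_add_leqif W <[x]>)) // dim_vline -addn1 leq_add2l leq_b1.
have sW : (W <= W + <[x]>)%VS by exact: addvSl.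
rewrite ltn_neqAle (dimv_leqif_sup sW) dimvS // andbT.
apply: contra xW => /subvP; apply.
exact: (subvP (addvSr _ _) _ (memv_line x)).
Qed.

Let fvT := finvect_type vT.

Lemma card_diff_vspace W U : (W <= U)%VS ->
  #|[pred x : fvT | (x \in U) && (x \notin W)]|%:R =
    #|F|%:R ^+ \dim U - #|F|%:R ^+ \dim W :> rat.
Proof.
move=> sWU; rewrite -!(@card_finvect F vT).
rewrite -(cardID (fun x : fvT => x \in W) [pred x : fvT | x \in U]) natrD.
have -> : #|[predI [pred x : fvT | x \in U] & (fun x : fvT => x \in W)]| =
    #|[pred x : fvT | x \in W]|.
  by apply: eq_card => x; rewrite !inE unfold_in andb_idl //; apply: (subvP sWU).
rewrite addrAC subrr add0r; congr _%:R.
by apply: eq_card => x; rewrite !inE andbC unfold_in.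
Qed.

Definition interval W V (d : nat) : {set {vspace vT}} :=
  [set U | [&& (W <= U)%VS, (U <= V)%VS & \dim U == d]].

(** Induction on [b] for all [W], counting in two ways the pairs of a subspace [U] and a vector [x]
    of [U] outside [W]: by [U], through the size of the difference; by [x], through the subspaces
    above W + <x>, whose dimension is one more than that of [W]. *)
Lemma card_interval W V b : (W <= V)%VS ->
  #|interval W V (\dim W + b)%N|%:R = gauss #|F| (\dim V - \dim W)%N b.
Proof.
have q1 := card_field_gt1.
elim: b W => [|b IHb] W sWV.
  rewrite gauss0 addn0 [interval _ _ _](_ : _ = [set W]) ?cards1 //.
  apply/setP=> U; rewrite !inE; apply/and3P/eqP => [[sWU _ eqd]|->]; last by rewrite subvv.
  by apply/esym/eqP; rewrite eqEdim sWU (eqP eqd) leqnn.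
set q := #|F|.
pose w : nat := \dim W; pose v : nat := \dim V.
have qw : q%:R ^+ w != 0 :> rat by rewrite expf_neq0 // pnatr_eq0; lia.
have lewv : (w <= v)%N by exact: dimvS.
have key : #|interval W V (w + b.+1)%N|%:R * (q%:R ^+ (w + b.+1) - q%:R ^+ w)
    = (q%:R ^+ v - q%:R ^+ w) * gauss q (v - w.+1) b :> rat.
  rewrite -(card_diff_vspace sWV) -!sum1_card !natr_sum !mulr_suml.
  transitivity (\sum_(U in interval W V (w + b.+1)%N)
      \sum_(x : fvT | (x \in V) && (x \notin W)) (x \in U)%:R : rat).
    apply: eq_bigr => U; rewrite inE => /and3P[sWU sUV /eqP dU].
    rewrite mul1r -dU -(card_diff_vspace sWU) -sum1_card natr_sum big_mkcond.
    rewrite [RHS]big_mkcond; apply: eq_bigr => x _; rewrite !inE.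
    by case xU: (x \in U) => /=; rewrite ?(subvP sUV _ xU) // if_same.
  rewrite exchange_big; apply: eq_bigr => x /andP[xV xW].
  have sWx : (W + <[x : vT]> <= V)%VS by rewrite subv_add sWV -memvE.
  rewrite mul1r /w -(dim_add_line xW) -IHb // dim_add_line // addSnnS.
  rewrite -sum1_card natr_sum big_mkcond [RHS]big_mkcond; apply: eq_bigr => U _.
  rewrite !inE subv_add -memvE.
  by case: (W <= U)%VS; case: (x \in U); case: (U <= V)%VS; case: (_ == _).
(* When W = V there is no vector outside [W] to count and both sides vanish; otherwise the nonzero
   factors cancel. *)
have [eqwv|ltwv] := leqP v w.
  have ewv : v = w by apply/eqP; rewrite eqn_leq eqwv.
  move/eqP: key; rewrite ewv subrr mul0r mulf_eq0 exprD -[X in _ - X]mulr1 -mulrBr.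
  rewrite mulf_eq0 (negbTE qw) (negbTE (expr_sub1_neq0 b q1)) !orbF => /eqP->.
  by rewrite (eqP (_ : \dim V - \dim W == 0)%N) ?subn_eq0 ?gauss_small.
apply: (mulIf (expr_sub1_neq0 b q1)); apply: (mulfI qw).
have -> : (\dim V - \dim W = (v - w.+1).+1)%N by rewrite subnSK.
rewrite gaussSS // -/q subnSK // -/w.
transitivity (#|interval W V (w + b.+1)%N|%:R * (q%:R ^+ (w + b.+1) - q%:R ^+ w) : rat).
  by rewrite exprD; ring.
rewrite key -{1}(subnKC lewv) exprD; ring.
Qed.

Lemma card_subspaces V b :
  #|[set U : {vspace vT} | (U <= V)%VS && (\dim U == b)]|%:R = gauss #|F| (\dim V) b.
Proof.
have := card_interval b (sub0v V); rewrite dimv0 subn0 add0n => <-.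
by congr _%:R; apply: eq_card => U; rewrite !inE sub0v.
Qed.

End SubspaceCount.

(** * Weight enumerators through supports of subcodes *)

Section SupportEnumerator.

Variables (F : finFieldType) (vT wT : vectType F) (R : comAlgType rat).
Variables (x y : R).

Let q := #|F|.
Let N := dim wT.

Implicit Types (U W : {vspace wT}) (D C : {vspace vT}).

Definition bprod (l : nat) : R := \prod_(j < l) (x - q%:R ^+ j *: y).

Lemma dim_le_dim U : (\dim U <= N)%N.
Proof. by rewrite /N -dimvf dimvS ?subvf. Qed.

Lemma sum_by_dim (V : nmodType) (P : pred {vspace wT}) (g : {vspace wT} -> V) :
  \sum_(U | P U) g U = \sum_(d < N.+1) \sum_(U | P U && (\dim U == d)) g U.
Proof.
rewrite (partition_big (fun U => inord (\dim U) : 'I_N.+1) xpredT) //=.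
apply: eq_bigr => d _; apply: eq_bigl => U.
by rewrite -val_eqE /= inordK // ltnS dim_le_dim.
Qed.

(** There are [gauss #|F| (N - w) v] subspaces of dimension w + v above [W], so grouping by v leaves
    y^w times the q-binomial sum for N - w. *)
Lemma sum_superspaces W :
  \sum_(U | (W <= U)%VS) y ^+ \dim U * bprod (N - \dim U) =
    x ^+ (N - \dim W) * y ^+ \dim W.
Proof.
pose w : nat := \dim W.
rewrite (partition_big (fun U => inord (\dim U - w) : 'I_(N - w).+1) xpredT) //=.
rewrite -(sum_bernstein (N - w) x y (card_field_gt1 F)) mulr_suml.
apply: eq_bigr => v _.
have -> : gauss #|F| (N - w) v = #|interval W fullv (w + v)|%:R.
  by rewrite card_interval ?subvf // dimvf.
rewrite scaler_nat -/w -sumr_const mulr_suml.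
apply: eq_big => [U|U /andP[sWU]].
  rewrite !inE subvf /=; case sWU: (W <= U)%VS => //=.
  have lewu : (w <= \dim U)%N by exact: dimvS.
  rewrite -val_eqE /= inordK; last by rewrite ltnS leq_sub2r // dim_le_dim.
  by rewrite -(eqn_add2l w) subnKC.
have lewu : (w <= \dim U)%N by exact: dimvS.
rewrite -val_eqE /= inordK; last by rewrite ltnS leq_sub2r // dim_le_dim.
move=> /eqP <-; rewrite -subnDA subnKC // mulrAC -exprD subnK //.
Qed.

(* [Dsupp] and [short] form a Galois connection: a subcode has its support in
   [U] exactly when it lies in the subcode shortened to [U]. *)
Lemma support_enumE C (Dsupp : {vspace vT} -> {vspace wT})
    (short : {vspace wT} -> {vspace vT}) (i l : nat) :
    dim wT = l ->
    (forall D U, (D <= short U)%VS = (D <= C)%VS && (Dsupp D <= U)%VS) ->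
  \sum_(w < l.+1) (\sum_(W : {vspace wT} | \dim W == w)
      #|[set D : {vspace vT} | [&& (D <= C)%VS, \dim D == i & Dsupp D == W]]|%:R)
        *: (x ^+ (l - w) * y ^+ w) =
  \sum_(u < l.+1) (\sum_(U : {vspace wT} | \dim U == u)
      qbinom q (\dim (short U))%:Z i%:Z) *: (y ^+ u * bprod (l - u)) :> R.
Proof.
move=> <- galois; rewrite -/N.
transitivity (\sum_(D : {vspace vT} | (D <= C)%VS && (\dim D == i))
    x ^+ (N - \dim (Dsupp D)) * y ^+ \dim (Dsupp D)).
  rewrite (partition_big Dsupp xpredT) //= sum_by_dim; apply: eq_bigr => w _.
  rewrite scaler_suml; apply: eq_bigr => W /eqP <-.
  rewrite scaler_nat -sumr_const; apply: eq_big => [D|D].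
    by rewrite inE andbA.
  by rewrite inE => /and3P[_ _ /eqP->].
transitivity (\sum_(U : {vspace wT}) qbinom q (\dim (short U))%:Z i%:Z
    *: (y ^+ \dim U * bprod (N - \dim U))); last first.
  rewrite sum_by_dim; apply: eq_bigr => u _.
  by rewrite scaler_suml; apply: eq_bigr => U /eqP->.
under eq_bigr do rewrite -sum_superspaces.
(* For fixed [U], the subcodes that remain are the subspaces of dimension [i] of [short U]. *)
rewrite (exchange_big_dep xpredT) //=; apply: eq_bigr => U _.
rewrite qbinomE -card_subspaces scaler_nat -sumr_const; apply: eq_bigl => D.
by rewrite inE galois andbAC.
Qed.

End SupportEnumerator.

Lemma bigminn_leq (I : finType) (P : pred I) (f : I -> nat) (a : nat) (j : I) :
  P j -> (\big[minn/a]_(l | P l) f l <= f j)%N.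
Proof. by move=> Pj; rewrite -minEnat -leEnat; apply: bigmin_le_cond. Qed.

(** * Optimal anticodes and the trace form *)

Section Anticodes.

Variables (F : finFieldType) (n m : nat).
Implicit Types (A C S : {vspace 'M[F]_(n, m)}) (M N : 'M[F]_(n, m)).

Lemma mxtrace_delta_mul (p r : nat) (i : 'I_p) (j : 'I_r) (B : 'M[F]_(r, p)) :
  \tr (delta_mx i j *m B) = B j i.
Proof.
rewrite /mxtrace (bigD1 i) //= big1 => [|l nli]; last first.
  by rewrite !mxE big1 // => s _; rewrite !mxE (negbTE nli) mul0r.
rewrite addr0 mxE (bigD1 j) //= big1 => [|s nsj]; last first.
  by rewrite !mxE (negbTE nsj) andbF mul0r.
by rewrite mxE !eqxx mul1r addr0.
Qed.

Lemma mxtrace_mul_eq0 (p r : nat) (B : 'M[F]_(r, p)) :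
  (forall X : 'M[F]_(p, r), \tr (X *m B) = 0) -> B = 0.
Proof. by move=> trB; apply/matrixP=> j i; rewrite -mxtrace_delta_mul trB mxE. Qed.

(** A coordinate of the projection onto a complement along [S] is a nonzero functional vanishing on
    [S]; the matrix [N] of its values on the unit matrices represents it through the trace. *)
Lemma exists_orthogonal S : S != fullv ->
  exists2 N, N != 0 & forall M, M \in S -> \tr (M *m N^T) = 0.
Proof.
move=> nS; pose T := (S^C)%VS.
have TS0 : (T :&: S)%VS = 0%VS by rewrite capvC capv_compl.
have ST0 : (S :&: T)%VS = 0%VS by rewrite capv_compl.
have TSf : (T + S)%VS = fullv by rewrite addvC addv_complf.
have dT : (0 < \dim T)%N.
  rewrite lt0n dimv_eq0; apply: contra nS => /eqP T0.
  by rewrite -TSf T0 add0v.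
pose i0 := Ordinal dT.
pose f M : F := coord (vbasis T) i0 (daddv_pi T S M).
have fsum (I : finType) (G : I -> 'M[F]_(n, m)) :
  f (\sum_i G i) = \sum_i f (G i) by rewrite /f !linear_sum.
have fZ a M : f (a *: M) = a * f M by rewrite /f !linearZ.
pose N := \matrix_(i, j) f (delta_mx i j).
have trN M : \tr (M *m N^T) = f M.
  rewrite {2}[M]matrix_sum_delta fsum; apply: eq_bigr => i _.
  rewrite fsum mxE; apply: eq_bigr => j _.
  by rewrite fZ !mxE.
exists N => [|M MS].
  apply/eqP => N0; have := trN (vbasis T)`_i0.
  rewrite N0 trmx0 mulmx0 linear0 /f daddv_pi_id //; last first.
    by rewrite vbasis_mem // mem_nth ?size_tuple.
  rewrite coord_free ?(basis_free (vbasisP T)) // eqxx => /esym/eqP.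
  by rewrite oner_eq0.
rewrite trN /f; have := daddv_pi_add TS0 (_ : M \in (T + S)%VS).
rewrite TSf memvf (daddv_pi_id ST0 MS) => /(_ isT).
by rewrite -[X in _ = X]add0r => /addIr ->; rewrite linear0.
Qed.

(* The properties of the optimal anticodes of matrices whose column (or row)
   space lies in a fixed space of dimension [u]. *)
Definition support_anticode A (u : nat) : Prop :=
  [/\ \dim A = (m * u)%N, {in A, forall M, \rank M <= u}%N,
      exists2 M, M \in A & \rank M = u
    & forall N, {in A, forall M, \tr (M *m N^T) = 0} -> (\rank N + u <= n)%N].

Lemma gen_weight_le C (i : nat) : (0 < m)%N -> (gen_weight C i <= n)%N.
Proof.
move=> m0; rewrite /gen_weight -[leqRHS](mulKn n m0) leq_div2r //.
(* A minimum is at most its default, here [m * n]. *)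
by rewrite -minEnat -leEnat; apply: bigmin_le_id.
Qed.

(** Otherwise [A], an optimal anticode because rank [u] is attained, would be a candidate in the
    minimum. *)
Lemma dim_cap_lt_gen_weight A C (u i : nat) : (0 < m)%N ->
  support_anticode A u -> (u < gen_weight C i)%N -> (\dim (A :&: C) < i)%N.
Proof.
move=> m0 [dA rA [M MA rM] _]; rewrite !ltnNge; apply: contra => leid.
rewrite /gen_weight -[leqRHS](mulKn u m0) -dA leq_div2r //.
apply: (bigminn_leq (fun A : {vspace 'M[F]_(n, m)} => \dim A) _).
rewrite leid andbT /optimal_anticode dA; apply/eqP; congr (_ * _)%N.
apply/eqP; rewrite eqn_leq; apply/andP; split; last exact/bigmax_leqP.
by rewrite -rM; apply: leq_bigmax_cond.
Qed.

(** A nonzero [N] orthogonal to A + C would lie in the dual, so have rank at least [dual_dist C],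
    yet rank at most n - u by orthogonality to [A]. Hence A + C is the whole space and the dimension
    formula applies. *)
Lemma dim_cap_dual_dist A C (u : nat) :
  support_anticode A u -> (n - u < dual_dist C)%N ->
  (\dim (A :&: C) + m * n = \dim C + m * u)%N.
Proof.
move=> [dA _ _ orthA] ltd.
have full : (A + C)%VS = fullv.
  apply/eqP; apply: contraLR ltd => /exists_orthogonal[N N0 orthN].
  rewrite -leqNgt; apply: (@leq_trans (\rank N)).
    apply: (bigminn_leq (fun N : 'M[F]_(n, m) => \rank N) _).
    rewrite N0 andbT inE; apply/forall_inP => M MC.
    by apply/eqP/orthN; rewrite (subvP (addvSr A C)).
  have rN : (\rank N + u <= n)%N.
    by apply: orthA => M MA; apply: orthN; rewrite (subvP (addvSl A C)).
  by rewrite leq_subRL ?(leq_trans _ rN) ?leq_addl // addnC.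
have := dimv_sum_cap A C; rewrite full dimvf dim_matrix dA => e.
by rewrite addnC [(m * n)%N]mulnC -[(n * m)%N]/(n * m)%R e addnC.
Qed.

(** The map from X to E^T X preserves rank, hence is injective, and [u <= m] lets rank [u] occur. By
    cyclicity of the trace, a matrix [N] orthogonal to the image satisfies E N = 0. *)
Lemma col_anticode (u : nat) (E : 'M[F]_(u, n)) : (u <= m)%N -> row_free E ->
  support_anticode (limg (linfun (mulmx E^T : 'M_(u, m) -> 'M_(n, m)))) u.
Proof.
move=> leum freeE; set A := limg _.
have memA X : E^T *m X \in A.
  by rewrite -[_ *m _](lfunE (mulmx E^T : 'M_(u, m) -> 'M_(n, m))) memv_img ?memvf.
have rkE X : \rank (E^T *m X : 'M_(n, m)) = \rank X.
  by rewrite -mxrank_tr trmx_mul trmxK mxrankMfree // mxrank_tr.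
split.
- rewrite limg_dim_eq ?dimvf ?dim_matrix ?[(m * u)%N]mulnC //.
  apply/eqP; rewrite -subv0; apply/subvP => X.
  rewrite memv_cap memvf /= memv_ker lfunE /= memv0 => /eqP EX0.
  by rewrite -mxrank_eq0 -rkE EX0 mxrank0.
- by move=> _ /memv_imgP[X _ ->]; rewrite lfunE rkE rank_leq_row.
- by exists (E^T *m pid_mx u); rewrite ?memA // rkE rank_pid_mx.
move=> N orthN; have: E *m N = 0.
  rewrite -[E]trmxK -[N]trmxK -trmx_mul; apply/eqP; rewrite trmx_eq0; apply/eqP.
  apply: mxtrace_mul_eq0 => X; rewrite mulmxA mxtrace_mulC mulmxA.
  exact/orthN/memA.
by move/mulmx0_rank_max; rewrite addnC (eqP freeE).
Qed.

(** Here orthogonality gives E N^T = 0, which bounds the rank of [N] by m - u; [n = m] turns this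
    bound and the dimension n u into the required form. *)
Lemma row_anticode (u : nat) (E : 'M[F]_(u, m)) :
  n = m -> (u <= n)%N -> row_free E ->
  support_anticode (limg (linfun (mulmxr E : 'M_(n, u) -> 'M_(n, m)))) u.
Proof.
move=> enm leun freeE; set A := limg _.
have memA X : X *m E \in A.
  by rewrite -[_ *m _](lfunE (mulmxr E : 'M_(n, u) -> 'M_(n, m))) memv_img ?memvf.
have rkE X : \rank (X *m E : 'M_(n, m)) = \rank X by rewrite mxrankMfree.
split.
- rewrite limg_dim_eq ?dimvf ?dim_matrix; first by rewrite -{1}enm.
  apply/eqP; rewrite -subv0; apply/subvP => X.
  rewrite memv_cap memvf /= memv_ker lfunE /= memv0 => /eqP EX0.
  by rewrite -mxrank_eq0 -rkE EX0 mxrank0.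
- by move=> _ /memv_imgP[X _ ->]; rewrite lfunE rkE rank_leq_col.
- by exists (pid_mx u *m E); rewrite ?memA // rkE rank_pid_mx.
move=> N orthN; have: E *m N^T = 0.
  by apply: mxtrace_mul_eq0 => X; rewrite mulmxA; apply/orthN/memA.
move/mulmx0_rank_max; rewrite addnC mxrank_tr (eqP freeE) => /leq_trans; apply.
by rewrite -enm.
Qed.

End Anticodes.

(** * Shortened codes and binomial moments *)

Section ShortenedCodes.

Variables (F : finFieldType) (n m : nat).
Implicit Types (C D : {vspace 'M[F]_(n, m)}).

(** Links subspaces to the row-space calculus of matrices. *)
Definition vspace_mx (p : nat) (U : {vspace 'rV[F]_p}) : 'M[F]_(\dim U, p) :=
  \matrix_i (vbasis U)`_i.

Lemma vspace_mx_free (p : nat) (U : {vspace 'rV[F]_p}) : row_free (vspace_mx U).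
Proof.
apply: inj_row_free => v; rewrite mulmx_sum_row => v0.
apply/rowP => i; rewrite mxE.
have /freeP freeU := basis_free (vbasisP U).
apply: (freeU (fun i => v 0 i)).
by rewrite -[RHS]v0; apply: eq_bigr => j _; rewrite rowK.
Qed.

Lemma memv_vspace_mx (p : nat) (U : {vspace 'rV[F]_p}) (x : 'rV[F]_p) :
  (x \in U) = (x <= vspace_mx U)%MS.
Proof.
apply/idP/submxP => [/coord_vbasis->|[v ->]].
  exists (\row_i coord (vbasis U) i x); rewrite mulmx_sum_row.
  by apply: eq_bigr => i _; rewrite rowK mxE.
rewrite mulmx_sum_row memv_suml // => i _.
by rewrite memvZ // rowK vbasis_mem // mem_nth ?size_tuple.
Qed.

Lemma short_row_anticode C (U : {vspace 'rV[F]_m}) : n = m ->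
  exists2 A, support_anticode A (\dim U) & short_row C U = (A :&: C)%VS.
Proof.
move=> enm; have ledn : (\dim U <= n)%N.
  by rewrite (leq_trans (dim_le_dim U)) // dim_matrix mul1r enm.
(* The witness consists of the products X E, where the rows of E form a basis of [U]. *)
eexists; first exact: (row_anticode enm ledn (vspace_mx_free U)).
apply/vspaceP => M; rewrite mem_short_row memv_cap andbC; congr (_ && _).
rewrite rowspace_sub; apply/forallP/memv_imgP => [UM | [X _ ->] j].
  have /submxP[X ->] : (M <= vspace_mx U)%MS.
    by apply/row_subP => j; rewrite -memv_vspace_mx.
  by exists X; rewrite ?memvf ?lfunE.
by rewrite lfunE /= memv_vspace_mx row_mul submxMl.
Qed.

Lemma short_col_anticode C (U : {vspace 'cV[F]_n}) : (n <= m)%N ->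
  exists2 A, support_anticode A (\dim U) & short_col C U = (A :&: C)%VS.
Proof.
move=> lenm; have ledm : (\dim U <= m)%N.
  by rewrite (leq_trans (dim_le_dim U)) // dim_matrix mulr1.
(* Basis matrices are built from row vectors, so [U] is transposed first. *)
pose tr := linfun (trmx : 'cV[F]_n -> 'rV[F]_n).
have memUt (x : 'cV[F]_n) : (x^T \in tr @: U)%VS = (x \in U).
  apply/idP/idP => [/memv_imgP[y Uy] | Ux].
    by rewrite lfunE => /trmx_inj->.
  by rewrite -[x^T](lfunE trmx) memv_img.
have dUt : \dim (tr @: U) = \dim U.
  apply: limg_dim_eq; apply/eqP; rewrite -subv0; apply/subvP => x.
  by rewrite memv_cap memv_ker lfunE /= trmx_eq0 memv0 => /andP[].
rewrite -{1}dUt; rewrite -dUt in ledm.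
eexists; first exact: (col_anticode ledm (vspace_mx_free (tr @: U))).
apply/vspaceP => M; rewrite mem_short_col memv_cap andbC; congr (_ && _).
rewrite colspace_sub; apply/forallP/memv_imgP => [UM | [X _ ->] j].
  have /submxP[X eX] : (M^T <= vspace_mx (tr @: U))%MS.
    by apply/row_subP => j; rewrite -tr_col -memv_vspace_mx memUt.
  by exists X^T; rewrite ?memvf // lfunE /= -trmx_mul -eX trmxK.
rewrite lfunE /= -memUt memv_vspace_mx tr_col trmx_mul trmxK.
by rewrite row_mul submxMl.
Qed.

(** The Galois connection required by [support_enumE], for column supports. *)
Lemma sub_short_col C D (U : {vspace 'cV[F]_n}) :
  (D <= short_col C U)%VS =
    (D <= C)%VS && (\sum_(M in D) colspace M <= U)%VS.
Proof.
apply/subvP/andP => [sD | [/subvP DC /subv_sumP DU] M DM].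
  split; first by apply/subvP => M /sD; rewrite mem_short_col => /andP[].
  by apply/subv_sumP => M /sD; rewrite mem_short_col => /andP[].
by rewrite mem_short_col DC ?DU.
Qed.

Lemma sub_short_row C D (U : {vspace 'rV[F]_m}) :
  (D <= short_row C U)%VS =
    (D <= C)%VS && (\sum_(M in D) rowspace M <= U)%VS.
Proof.
apply/subvP/andP => [sD | [/subvP DC /subv_sumP DU] M DM].
  split; first by apply/subvP => M /sD; rewrite mem_short_row => /andP[].
  by apply/subv_sumP => M /sD; rewrite mem_short_row => /andP[].
by rewrite mem_short_row DC ?DU.
Qed.

(** For n = m the column and row cases of [support_enumE] are averaged. *)
Lemma weight_enumE C (i : nat) :
  weight_enum C i =
    \sum_(u < n.+1) binom_moment C i u *: ('X_1 ^+ u * bprod F 'X_0 'X_1 (n - u)).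
Proof.
pose X : {mpoly rat[2]} := 'X_0; pose Y : {mpoly rat[2]} := 'X_1.
have colE := support_enumE X Y i (etrans (dim_matrix F n 1) (mulr1 n))
  (sub_short_col C).
rewrite /weight_enum /weight_num /binom_moment.
case: eqVneq => [enm|_]; last exact: colE.
have dR : dim 'rV[F]_m = n by rewrite dim_matrix mul1r -enm.
have rowE := support_enumE X Y i dR (sub_short_row C).
under eq_bigr do rewrite mulrC -scalerA scalerDl.
under [RHS]eq_bigr do rewrite mulrC -scalerA scalerDl.
by rewrite -!scaler_sumr !big_split; congr (_ *: (_ + _)); [exact: colE | exact: rowE].
Qed.

Lemma half_double (a : rat) : (a + a) / 2%:R = a.
Proof. by field. Qed.

Lemma binom_moment_lt_gen_weight C (i u : nat) : (0 < m)%N -> (n <= m)%N ->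
  (u < gen_weight C i)%N -> binom_moment C i u = 0.
Proof.
move=> m0 lenm ltud; rewrite /binom_moment.
have -> : \sum_(U : {vspace 'cV[F]_n} | \dim U == u)
    qbinom #|F| (\dim (short_col C U))%:Z i%:Z = 0.
  apply: big1 => U /eqP dU; have [A] := short_col_anticode C U lenm.
  rewrite dU => antiA ->; rewrite qbinomE gauss_small //.
  exact: dim_cap_lt_gen_weight antiA ltud.
case: eqP => // enm; rewrite add0r big1 ?mul0r // => U /eqP dU.
have [A] := short_row_anticode C U enm.
rewrite dU => antiA ->; rewrite qbinomE gauss_small //.
exact: dim_cap_lt_gen_weight antiA ltud.
Qed.

Lemma sum_dim_const (wT : vectType F) (u : nat) (a : rat) :
  \sum_(U : {vspace wT} | \dim U == u) a = gauss #|F| (dim wT) u * a.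
Proof.
rewrite -dimvf -card_subspaces sumr_const mulr_natl; congr (_ *+ _).
by apply: eq_card => U; rewrite !inE subvf.
Qed.

(** [dim_cap_dual_dist] makes all summands equal, and the Gaussian coefficient counts them. *)
Lemma binom_moment_dual_dist C (i u : nat) : (n <= m)%N -> (u <= n)%N ->
    (n - u < dual_dist C)%N ->
  binom_moment C i u =
    gauss #|F| n u * qbinom #|F| ((\dim C)%:Z - m%:Z * (n%:Z - u%:Z)) i%:Z.
Proof.
move=> lenm leun ltd.
have dimE A : support_anticode A u ->
    (\dim (A :&: C))%:Z = (\dim C)%:Z - m%:Z * (n%:Z - u%:Z).
  move=> /dim_cap_dual_dist-/(_ C ltd) e.
  rewrite mulrBr opprB addrA -!PoszM -PoszD -e PoszD; ring.
rewrite /binom_moment; set b := qbinom _ (_ - _) _.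
have -> : \sum_(U : {vspace 'cV[F]_n} | \dim U == u)
    qbinom #|F| (\dim (short_col C U))%:Z i%:Z = gauss #|F| n u * b.
  transitivity (\sum_(U : {vspace 'cV[F]_n} | \dim U == u) b).
    apply: eq_bigr => U /eqP dU; have [A] := short_col_anticode C U lenm.
    by rewrite dU => /dimE eA ->; rewrite eA.
  by rewrite sum_dim_const dim_matrix mulr1.
case: eqP => // enm; rewrite [X in _ + X](_ : _ = gauss #|F| n u * b) ?half_double //.
transitivity (\sum_(U : {vspace 'rV[F]_m} | \dim U == u) b).
  apply: eq_bigr => U /eqP dU; have [A] := short_row_anticode C U enm.
  by rewrite dU => /dimE eA ->; rewrite eA.
by rewrite sum_dim_const dim_matrix mul1r -enm.
Qed.

End ShortenedCodes.

(** * Comparison with the Cauchy product *)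

Lemma coef_phi (q n u : nat) : (u <= n)%N -> (phi q n)`_(n - u) = bernstein q n u.
Proof.
move=> leun; rewrite /phi coef_sum (bigD1 (Ordinal (leun : u < n.+1)%N)) //=.
rewrite coefCM coefXn eqxx mulr1 big1 ?addr0 // => v.
rewrite -val_eqE /= => nvu; rewrite coefCM coefXn.
have levn : (v <= n)%N by rewrite -ltnS.
(* No other [v <= n] gives the exponent [n - u]. *)
by case: eqP => [e|]; rewrite ?mulr0 //; move/eqP: nvu; lia.
Qed.

(** In the range of the quotient the nonzero denominator cancels; past it, the negated test says n -
    (d + j) < [dual_dist C], where the moment has its closed form. *)
Lemma zeta_binom_moment (F : finFieldType) (n m i j : nat)
    (C : {vspace 'M[F]_(n, m)}) :
    (n <= m)%N -> (gen_weight C i + j <= n)%N ->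
  zeta C i j * gauss #|F| n (gen_weight C i + j) =
    binom_moment C i (gen_weight C i + j).
Proof.
set d := gen_weight C i => lenm ledj.
rewrite /zeta /norm_moment -/d ltz_nat ltn0.
have -> : j%:Z + d%:Z = (d + j)%N%:Z by rewrite addrC.
case: ifP => [_|gtu]; first by rewrite qbinomE divfK ?gauss_neq0 ?card_field_gt1.
rewrite binom_moment_dual_dist //; last by move: gtu; lia.
by rewrite mulrC; congr (_ * qbinom _ _ _); rewrite PoszD; ring.
Qed.

Theorem lemma5p6 (F : finFieldType) (n m k i : nat)
    (C : {vspace 'M[F]_(n, m)})
    (hn : (2 <= n)%N) (hnm : (n <= m)%N) (hk : \dim C = k) (hi : (i <= k)%N) :
  weight_enum C i =
    ps_mul (fun u => (zeta C i u)%:MP) (fun j => (phi #|F| n)`_j)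
      (n - gen_weight C i)%N.
Proof.
subst k; have m0 : (0 < m)%N by apply: leq_trans hnm; apply: leq_trans hn.
set d := gen_weight C i; have ledn : (d <= n)%N by exact: gen_weight_le.
rewrite weight_enumE /ps_mul -(big_mkord xpredT (fun u =>
  binom_moment C i u *: ('X_1 ^+ u * bprod F 'X_0 'X_1 (n - u)))).
(* The moments below [d] vanish; the others are reindexed by u = d + j. *)
rewrite (@big_cat_nat _ _ _ d) //=; last exact: leqW.
rewrite big_nat big1 => [|u /andP[_ ltud]]; last first.
  by rewrite binom_moment_lt_gen_weight ?scale0r.
rewrite add0r -{1}[d]add0n big_addn big_mkord subSn //.
apply: eq_bigr => j _; have lej : (d + j <= n)%N.
  by rewrite -leq_subRL // -ltnS.
(* The coefficient of T^(n-d-j) in [phi] is the Bernstein polynomial of index d + j; its Gaussian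
   factor turns the zeta coefficient into the moment. *)
rewrite -subnDA coef_phi // mul_mpolyC /bernstein scalerA qbinomE.
by rewrite zeta_binom_moment // addnC.
Qed.
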